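(* (1) Every Hausdorff topological group $G$ is a BR-group. (2) Moreover, for every Hausdorff topological group $G$ there exists a t-exact birepresentation $$\Psi = \{\omega: E \times F \to \mathbb{R},\ h_1: G \to \mathrm{Iso}(E),\ h_2: G \to \mathrm{Iso}(F)\}$$ of $G$ such that $\omega$ is a regular strong duality and $E$ and $F$ are Banach spaces with density not greater than $w(G)$.
   Context: For a normed space $V$, $B_V$ is the closed unit ball and $\mathrm{Iso}(V)$ is the topological group of all linear onto isometries of $V$ with the strong operator topology (pointwise convergence on $V$). $w$ denotes weight and density is the least cardinality of a dense subset; all these cardinals are taken to be infinite (i.e. replaced by $\aleph_0$ if finite). A bilinear map $\omega: E \times F \to \mathbb{R}$ (write $f(x) = \omega(x,f)$) on normed spaces is a left strong duality if for every norm-unbounded sequence $(x_n)$ in $E$ the set $\{f(x_n): n \in \mathbb{N}, f \in B_F\}$ is unbounded in $\mathbb{R}$; a right strong duality if for every norm-unbounded sequence $(f_n)$ in $F$ the set $\{f_n(x): n \in \mathbb{N}, x \in B_E\}$ is unbounded; a strong duality if both. $\omega$ is regular if $|\omega(x,f)| \leq \|x\|\,\|f\|$ for all $(x,f) \in E \times F$. A continuous birepresentation of $G$ in a continuous bilinear map $\omega: E \times F \to \mathbb{R}$ (with $E,F$ normed spaces) is a pair of continuous homomorphisms $h_1: G \to \mathrm{Iso}(E)$, $h_2: G \to \mathrm{Iso}(F)$ such that $\omega(gx, gf) = \omega(x,f)$ for all $g \in G$, $x \in E$, $f \in F$, where $gx = h_1(g)(x)$, $gf = h_2(g)(f)$.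 ''Birepresentation'' here means continuous birepresentation. A system of continuous birepresentations of a Hausdorff topological group $(G,\tau)$ in $\omega_i: E_i \times F_i \to \mathbb{R}$, $i \in I$, is t-exact if for every strictly coarser (not necessarily Hausdorff) group topology $\tau' \subsetneq \tau$ on $G$ there is $i \in I$ such that at least one of the actions $(G,\tau') \times E_i \to E_i$, $(G,\tau') \times F_i \to F_i$ is not continuous. A single birepresentation is t-exact if the one-element system is. $G$ is a BR-group (birepresentable) if there exists a t-exact system of continuous birepresentations of $G$ in strong dualities $\omega_i$. *)

(* Defs.v *)
From HB Require Import structures.
From mathcomp Require Import all_boot all_order all_algebra.
From mathcomp Require Import all_classical all_reals all_analysis.

Set Implicit Arguments.
Unset Strict Implicit.
Unset Printing Implicit Defensive.

Import Order.TTheory GRing.Theory Num.Theory.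
Import numFieldNormedType.Exports.

Local Open Scope classical_set_scope.
Local Open Scope ring_scope.
Local Open Scope card_scope.

(* t-exactness compares several topologies on one group, so topologies are
   first-class values here; [topologized tau] is the carrier equipped with the
   topology [tau], and keeps the group structure of the carrier. *)
Record topology_on (T : Type) := TopologyOn {
  opens : set (set T);
  opensT : opens [set: T];
  opensI : setI_closed opens;
  opens_bigcup : forall D : set (set T),
    D `<=` opens -> opens (\bigcup_(A in D) A) }.

Lemma opens_bigcup_fam (T : Type) (tau : topology_on T) (I : Type)
  (f : I -> set T) : (forall i, opens tau (f i)) -> opens tau (\bigcup_i f i).
Proof.
move=> tauf; have -> : \bigcup_i f i = \bigcup_(A in range f) A.
  by rewrite bigcup_image.
by apply: opens_bigcup => _ [i _ <-].
Qed.

Definition topologized (T : Type) (tau : topology_on T) : Type := T.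

HB.instance Definition _ (T : choiceType) (tau : topology_on T) :=
  Choice.on (topologized tau).
HB.instance Definition _ (T : choiceType) (tau : topology_on T) :=
  isOpenTopological.Build (topologized tau)
    (opensT tau) (@opensI T tau) (@opens_bigcup_fam T tau).
HB.instance Definition _ (G : groupType) (tau : topology_on G) :=
  Group.copy (topologized tau) G.

Definition group_topology (G : groupType) (tau : topology_on G) : Prop :=
  continuous (fun p : topologized tau * topologized tau => (p.1 * p.2)%g) /\
  continuous (fun g : topologized tau => (g^-1)%g).

Section Iso.
Context {R : realType} (V : normedModType R).

Record Iso : Type := MkIso {
  iso_fun :> V -> V;
  iso_linear : linear iso_fun;
  iso_norm : forall x, `|iso_fun x| = `|x|;
  iso_onto : forall y, exists x, iso_fun x = y }.

Lemma iso_ext (u v : Iso) : u =1 v -> u = v.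
Proof.
case: u v => [f fl fn fo] [g gl gn go] /= /funext fg.
by rewrite fg in fl fn fo *; congr MkIso; exact: Prop_irrelevance.
Qed.

Lemma iso_inj (u : Iso) : injective u.
Proof.
move=> x y uxy; apply/eqP; rewrite -subr_eq0 -normr_eq0 -(iso_norm u).
by rewrite addrC -scaleN1r iso_linear uxy scaleN1r addNr normr0.
Qed.

Definition iso_one : Iso :=
  @MkIso idfun (fun _ _ _ => erefl) (fun=> erefl) (fun y => ex_intro _ y erefl).

Lemma iso_comp_linear (u v : Iso) : linear (u \o v).
Proof. by move=> a x y; rewrite /= !iso_linear. Qed.

Lemma iso_comp_norm (u v : Iso) x : `|(u \o v) x| = `|x|.
Proof. by rewrite /= !iso_norm. Qed.

Lemma iso_comp_onto (u v : Iso) y : exists x, (u \o v) x = y.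
Proof.
have [z <-] := iso_onto u y; have [x <-] := iso_onto v z.
by exists x.
Qed.

Definition iso_mul (u v : Iso) : Iso :=
  MkIso (iso_comp_linear u v) (iso_comp_norm u v) (iso_comp_onto u v).

Definition iso_inv_fun (u : Iso) (y : V) : V := projT1 (cid (iso_onto u y)).

Lemma iso_invK (u : Iso) : cancel (iso_inv_fun u) u.
Proof. by move=> y; rewrite /iso_inv_fun; case: cid. Qed.

Lemma iso_Kinv (u : Iso) : cancel u (iso_inv_fun u).
Proof. by move=> x; apply: (@iso_inj u); rewrite iso_invK. Qed.

Lemma iso_inv_linear (u : Iso) : linear (iso_inv_fun u).
Proof.
by move=> a x y; apply: (@iso_inj u); rewrite iso_linear !iso_invK.
Qed.

Lemma iso_inv_norm (u : Iso) x : `|iso_inv_fun u x| = `|x|.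
Proof. by rewrite -(iso_norm u) iso_invK. Qed.

Lemma iso_inv_onto (u : Iso) y : exists x, iso_inv_fun u x = y.
Proof. by exists (u y); rewrite iso_Kinv. Qed.

Definition iso_inv (u : Iso) : Iso :=
  MkIso (iso_inv_linear u) (iso_inv_norm u) (iso_inv_onto u).

Lemma iso_mulA : associative iso_mul.
Proof. by move=> u v w; apply: iso_ext. Qed.

Lemma iso_mul1 : left_id iso_one iso_mul.
Proof. by move=> u; apply: iso_ext. Qed.

Lemma iso_mulr1 : right_id iso_one iso_mul.
Proof. by move=> u; apply: iso_ext. Qed.

Lemma iso_mulV : left_inverse iso_one iso_inv iso_mul.
Proof. by move=> u; apply: iso_ext => x; exact: iso_Kinv. Qed.

Lemma iso_mulrV : right_inverse iso_one iso_inv iso_mul.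
Proof. by move=> u; apply: iso_ext => x; exact: iso_invK. Qed.

HB.instance Definition _ := gen_eqMixin Iso.
HB.instance Definition _ := gen_choiceMixin Iso.
HB.instance Definition _ := @isGroup.Build Iso iso_one iso_inv iso_mul
  iso_mulA iso_mul1 iso_mulr1 iso_mulV iso_mulrV.
(* strong operator topology *)
HB.instance Definition _ := Topological.copy Iso
  (initial_topology (iso_fun : Iso -> {ptws V -> V})).

End Iso.

Section IsoTopology.
Context {R : realType} {V : normedModType R}.

Lemma iso_cvgP (F : set_system (Iso V)) (u : Iso V) : Filter F ->
  F --> u <-> forall x, (fun v : Iso V => v x) @ F --> u x.
Proof.
move=> FF; split.
  move=> Fu; have /pointwise_cvgP : {ptws, @iso_fun R V @ F --> iso_fun u}; last by [].
  apply: (@cvg_fmap _ {ptws V -> V} F u (@iso_fun R V)) Fu.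
  exact: (@initial_continuous (Iso V) {ptws V -> V}).
move=> H; have Fu : {ptws, @iso_fun R V @ F --> iso_fun u} by apply/pointwise_cvgP.
move=> A.
move=> [_ [[B Bo <-] Bu] BA]; apply: filterS BA _.
by apply: Fu; apply: open_nbhs_nbhs; split.
Qed.

Lemma iso_opp (u : Iso V) x y : u (x - y) = u x - u y.
Proof. by rewrite addrC -scaleN1r iso_linear scaleN1r addrC. Qed.

Lemma iso_mul_continuous : continuous (fun p : Iso V * Iso V => (p.1 * p.2)%g).
Proof.
move=> [u v]; apply/iso_cvgP => x /=.
apply/cvgrPdist_lt => e e0.
have e2 : 0 < e / 2 by rewrite divr_gt0.
have /iso_cvgP/(_ x)/cvgrPdist_lt/(_ _ e2) Hv : nbhs v --> v by [].
have /iso_cvgP/(_ (v x))/cvgrPdist_lt/(_ _ e2) Hu : nbhs u --> u by [].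
rewrite near_map; near=> p.
have H2 : `|v x - p.2 x| < e / 2 by near: p; exact: (cvg_snd Hv).
have H1 : `|u (v x) - p.1 (v x)| < e / 2 by near: p; exact: (cvg_fst Hu).
change (`|u (v x) - p.1 (p.2 x)| < e).
rewrite -[u _](subrK (p.1 (v x))) -addrA -iso_opp.
by rewrite (le_lt_trans (ler_normD _ _))// iso_norm (splitr e) ltrD.
Unshelve. all: by end_near. Qed.

Lemma iso_inv_continuous : continuous (fun u : Iso V => (u^-1)%g).
Proof.
move=> u; have FF : Filter ((fun u : Iso V => (u^-1)%g) @ u) by apply: fmap_filter; exact: nbhs_filter.
apply/iso_cvgP => x; apply/cvgrPdist_lt => e e0.
have /iso_cvgP/(_ ((u^-1)%g x))/cvgrPdist_lt/(_ _ e0) : nbhs u --> u by [].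
rewrite near_map; apply: filterS => v; rewrite distrC -(iso_norm (v^-1)%g) iso_opp.
have -> : (v^-1)%g (v ((u^-1)%g x)) = (u^-1)%g x by exact: iso_Kinv.
by have -> : u ((u^-1)%g x) = x by exact: iso_invK.
Qed.

End IsoTopology.

Definition unit_ball (R : realType) (V : normedModType R) : set V :=
  [set x | `|x| <= 1].
Arguments unit_ball {R} V.

Section Dualities.
Context {R : realType} {E F : normedModType R}.
Implicit Type omega : {bilinear E -> F -> R | *%R & *%R}.

Definition left_strong omega : Prop := forall x : nat -> E,
  ~ bounded_set (range x) ->
  ~ bounded_set [set omega (x n) f | n in [set: nat] & f in unit_ball F].

Definition right_strong omega : Prop := forall f : nat -> F,
  ~ bounded_set (range f) ->
  ~ bounded_set [set omega x (f n) | n in [set: nat] & x in unit_ball E].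

Definition strong_duality omega : Prop := left_strong omega /\ right_strong omega.

Definition regular_duality omega : Prop :=
  forall x f, `|omega x f| <= `|x| * `|f|.

End Dualities.

Record birepresentation (R : realType) (G : groupType) (tau : topology_on G)
    (E F : normedModType R) := Birepresentation {
  pairing : {bilinear E -> F -> R | *%R & *%R};
  pairing_continuous : continuous (fun p : E * F => pairing p.1 p.2);
  hom1 : {multiplicative G -> Iso E};
  hom1_continuous : continuous (hom1 : topologized tau -> Iso E);
  hom2 : {multiplicative G -> Iso F};
  hom2_continuous : continuous (hom2 : topologized tau -> Iso F);
  pairing_invariant : forall g x f, pairing (hom1 g x) (hom2 g f) = pairing x f }.

Definition action_continuous (R : realType) (G : groupType)
    (V : normedModType R) (h : G -> Iso V) (tau : topology_on G) : Prop :=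
  continuous (fun p : topologized tau * V => h p.1 p.2).

Definition t_exact (R : realType) (G : groupType) (tau : topology_on G)
    (I : Type) (E F : I -> normedModType R)
    (Psi : forall i, birepresentation tau (E i) (F i)) : Prop :=
  forall tau' : topology_on G, group_topology tau' -> opens tau' `<` opens tau ->
  exists i, ~ action_continuous (hom1 (Psi i)) tau' \/
            ~ action_continuous (hom2 (Psi i)) tau'.

Definition t_exact1 (R : realType) (G : groupType) (tau : topology_on G)
    (E F : normedModType R) (Psi : birepresentation tau E F) : Prop :=
  t_exact (fun _ : unit => Psi).

Definition BR_group (R : realType) (G : groupType) (tau : topology_on G) : Prop :=
  exists (I : Type) (E F : I -> normedModType R)
         (Psi : forall i, birepresentation tau (E i) (F i)),
    t_exact Psi /\ forall i, strong_duality (pairing (Psi i)).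

(* Cardinals are represented by sets up to equipotence. [infinitized A] has
   the cardinal of [A], replaced by aleph_0 when [A] is finite. *)
Definition infinitized (T : Type) (A : set T) : set (T + nat) :=
  if `[< finite_set A >] then range inr else inl @` A.

Definition min_basis (T : topologicalType) (B : set (set T)) : Prop :=
  basis B /\ forall C : set (set T), basis C -> B #<= C.

Definition min_dense (T : topologicalType) (D : set T) : Prop :=
  dense D /\ forall C : set T, dense C -> D #<= C.

Definition density_le_weight (E T : topologicalType) : Prop :=
  exists (D : set E) (B : set (set T)),
    [/\ min_dense D, min_basis B & infinitized D #<= infinitized B].

(* Main.v *)
Require Import Defs.
From HB Require Import structures.
From mathcomp Require Import all_boot all_order all_algebra.
From mathcomp Require Import all_classical all_reals all_analysis.
From mathcomp Require Import lra.

(* A bounded continuous group seminorm [N] is uniformly continuous for both the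
   left and the right uniformity.  Let [E] be the closed span of the left
   translates of [N] for the Hölder-[1/2] norm of the left-invariant distance
   [N (h^-1 * k)], and [F] the closed span, in the dual of [E], of the
   evaluations [x |-> x h - x k].  The action on [F] is continuous because such a
   functional has norm at most [sqrt (N (h^-1 * k))], and the action on [E] is
   continuous because [min s t / sqrt t <= sqrt s]; the evaluations norm [E], and
   [F] carries the dual norm, so the duality is strong.  The orbit of [N] in [E]
   recovers [N], and the Birkhoff-Kakutani seminorms attached to the members of a
   minimal basis that contain the unit recover the topology; functions on the
   disjoint union of the corresponding copies of [G] treat them all at once.  The
   density bound is cardinal arithmetic. *)

Set Implicit Arguments.
Unset Strict Implicit.
Unset Printing Implicit Defensive.

Import Order.TTheory GRing.Theory Num.Theory.
Import numFieldNormedType.Exports.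

Local Open Scope classical_set_scope.
Local Open Scope ring_scope.
Local Open Scope card_scope.

(** * Comparison of cardinals, infinite cardinal arithmetic, weight and density *)

Lemma card_le_injP (T U : Type) (A : set T) (B : set U) :
  A #<= B <-> exists f : A -> B, injective f.
Proof.
split=> [/card_leP[f]|[f f_inj]].
  by exists f => x y; apply: (@inj _ _ _ f); rewrite inE.
apply/card_leP/injfunPex; exists f => // x y _ _; exact: f_inj.
Qed.

Lemma card_leTT_injP (T U : Type) :
  [set: T] #<= [set: U] <-> exists f : T -> U, injective f.
Proof.
split=> [/card_le_injP[f f_inj]|[f f_inj]].
  exists (fun x => val (f (SigSub (mem_set (I : [set: T] x))))).
  by move=> x y /val_inj/f_inj/(congr1 val).
apply/card_leP/injfunPex.
exists (fun x => SigSub (mem_set (I : [set: U] (f (val x))))) => //.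
by move=> x y _ _ /(congr1 val) /= /f_inj/val_inj.
Qed.

(* Hönig's argument: let [Z] be a maximal subset of the product of the [X i]
   all of whose projections are injective; one of them must be onto. *)
Lemma exists_min_inj (I : Type) (X : I -> Type) : inhabited I ->
  exists i, forall j, exists f : X i -> X j, injective f.
Proof.
move=> [i0].
pose P (Z : set (forall i, X i)) :=
  forall x y, Z x -> Z y -> (exists i, x i = y i) -> x = y.
have [|Z [PZ maxZ]] := @Zorn_bigcup _ P.
  move=> C CP Ctot x y [A CA Ax] [B CB By].
  by have [AB|BA] := Ctot _ _ CA CB;
    [apply: (CP B CB) => //; exact: AB|apply: (CP A CA) => //; exact: BA].
have [i onto_i] : exists i, forall a : X i, exists2 z, Z z & z i = a.
  apply: contrapT => /forallNP noti.
  have exa i : exists a : X i, forall z, Z z -> z i <> a.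
    have /existsNP[a na] := noti i.
    by exists a => z Zz zia; apply: na; exists z.
  pose a i := projT1 (cid (exa i)).
  have aP i : forall z, Z z -> z i <> a i := projT2 (cid (exa i)).
  apply: (maxZ (Z `|` [set (a : forall i, X i)])).
    by split=> [x|/(_ a (or_intror erefl)) /(aP i0)]; [left|].
  move=> x y [Zx|->] [Zy|->] //; first exact: PZ.
  - by case=> i /(aP _ _ Zx).
  - by case=> i /esym/(aP _ _ Zy).
have [a|z zP] := @choice _ _ (fun a z => Z z /\ z i = a).
  by have [z Zz zia] := onto_i a; exists z.
exists i => j; exists (fun a => z a j) => a b zab.
have [Zza zai] := zP a; have [Zzb zbi] := zP b.
by rewrite -zai -zbi (PZ _ _ Zza Zzb)//; exists j.
Qed.

(** This provides the least basis and the least dense set to which weight and density refer. *)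
Lemma exists_min_card (T : Type) (P : set (set T)) : P !=set0 ->
  exists2 A, P A & forall B, P B -> A #<= B.
Proof.
move=> [A0 PA0].
have [|[A PA] minA] := @exists_min_inj {A | P A} (fun A => set_type (sval A)).
  by constructor; exists A0.
by exists A => // B PB; apply/card_le_injP; exact: (minA (exist _ B PB)).
Qed.

(* A maximal partial injection [D * D -> D] with [D] infinite has [D] as large
   as its complement, since otherwise it extends to [D] and a disjoint copy. *)
Lemma infinite_square_inj (U : Type) (g : nat -> U) : injective g ->
  exists f : U -> U -> U, forall a b c d, f a b = f c d -> a = c /\ b = d.
Proof.
move=> g_inj.
(* [P Y] says that [Y] is the graph of an injective operation [fld Y * fld Y -> fld Y]; [fld] reads
   the domain off the diagonal. *)
pose fld (Y : set (U * U * U)) := [set a | exists c, Y (a, a, c)].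
pose P (Y : set (U * U * U)) := [/\
  forall p c c', Y (p, c) -> Y (p, c') -> c = c',
  forall p q c, Y (p, c) -> Y (q, c) -> p = q,
  forall a b c, Y (a, b, c) -> [/\ fld Y a, fld Y b & fld Y c] &
  forall a b, fld Y a -> fld Y b -> exists c, Y (a, b, c)].
(* The seed carries the coding of pairs of naturals over to the range of [g]. *)
pose Y0 := [set (g m, g n, g (pickle (m, n))) | m in setT & n in setT].
have PY0 : P Y0.
  have fldg n : fld Y0 (g n) by exists (g (pickle (n, n))); exists n => //; exists n.
  split.
  - move=> _ _ c' [m _ [n _ [<- <-]]] [m' _ [n' _ [/g_inj-> /g_inj-> <-]]] //.
  - move=> _ q _ [m _ [n _ [<- <-]]] [m' _ [n' _ [<-]]].
    by move=> /g_inj/(pcan_inj pickleK) [-> ->].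
  - by move=> _ _ _ [m _ [n _ [<- <- <-]]].
  - move=> a b [c [m _ [n _ [<- _ _]]]] [c' [m' _ [n' _ [<- _ _]]]].
    by exists (g (pickle (m, m'))); exists m => //; exists m'.
(* [Y0] is adjoined so that the empty chain satisfies the predicate too. *)
have [|Z [PZ maxZ]] := @Zorn_bigcup _ (fun Y => P (Y0 `|` Y)).
  move=> C CP Ctot.
  have [->|[Z0 CZ0]] : C = set0 \/ C !=set0.
    by have [->|/set0P] := eqVneq C set0; [left|right].
    by rewrite bigcup_set0 setU0.
  have -> : Y0 `|` \bigcup_(X in C) X = \bigcup_(X in C) (Y0 `|` X).
    apply/seteqP; split=> [x [Yx|[X CX Xx]]|x [X CX [Yx|Xx]]].
    - by exists Z0 => //; left.
    - by exists X => //; right.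
    - by left.
    - by right; exists X.
  set W := \bigcup_(X in C) _.
  have Wsub X : C X -> Y0 `|` X `<=` W by move=> CX x Xx; exists X.
  have fldW X : C X -> fld (Y0 `|` X) `<=` fld W.
    by move=> CX a [c Xc]; exists c; exact: Wsub Xc.
  have W2 x y : W x -> W y -> exists X, [/\ C X, (Y0 `|` X) x & (Y0 `|` X) y].
    move=> [X CX Xx] [Y CY Yy].
    have [XY|YX] := Ctot _ _ CX CY; [exists Y|exists X]; split=> //.
    + by case: Xx => [?|/XY ?]; [left|right].
    + by case: Yy => [?|/YX ?]; [left|right].
  split.
  - by move=> p c c' W1 /(W2 _ _ W1)[X [/CP[f _ _ _]]]; exact: f.
  - by move=> p q c W1 /(W2 _ _ W1)[X [/CP[_ i _ _]]]; exact: i.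
  - move=> a b c [X CX /=]; have [_ _ s _] := CP _ CX; move=> /s[? ? ?].
    by split; apply: (fldW X).
  - move=> a b [c Wc] [d /(W2 _ _ Wc)[X [CX Xc Xd]]].
    have [_ _ _ t] := CP _ CX.
    by have [||e /(Wsub X CX) ?] := t a b; [exists c|exists d|exists e].
set Y := Y0 `|` Z in PZ; have {PZ} [Yfun Yinj Yfld Ytot] := PZ.
have maxY Y' : Y `<=` Y' -> P Y' -> Y' `<=` Y.
  move=> YY' PY'; apply: contrapT => nY'Y; apply: (maxZ Y').
    by split=> [x Zx|Y'Z]; [apply: YY'; right|apply: nY'Y => x /Y'Z; right].
  by rewrite (_ : Y0 `|` Y' = Y')//; apply/setUidPr => x Yx; apply: YY'; left.
set D := fld Y in Yfld Ytot.
have Dg n : D (g n).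
  by exists (g (pickle (n, n))); left; exists n => //; exists n.
have [p|f fP] := @choice (U * U) U (fun p c => D p.1 -> D p.2 -> Y (p, c)).
  have [[D1 D2]|nD] := pselect (D p.1 /\ D p.2).
    by have [c Yc] := Ytot _ _ D1 D2; exists c; rewrite [p]surjective_pairing.
  by exists (g 0%N) => D1 D2; case: nD.
have fD a b : D a -> D b -> D (f (a, b)).
  by move=> Da Db; have [] := Yfld _ _ _ (fP (a, b) Da Db).
have f_inj a b c d : D a -> D b -> D c -> D d -> f (a, b) = f (c, d) ->
    a = c /\ b = d.
  move=> Da Db Dc Dd e; have := Yinj (a, b) (c, d) _ (fP (a, b) Da Db).
  by rewrite e => /(_ (fP (c, d) Dc Dd)) [-> ->].
have g01 : g 0%N <> g 1%N by move=> /g_inj.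
(* If [A] injects into [D], so does the union of [D] and [A]: points of [D] are paired with [g 0],
   the others with [g 1]. *)
have glue (j : U -> U) (A : set U) : (forall a, A a -> D (j a)) ->
    (forall a b, A a -> A b -> j a = j b -> a = b) ->
    exists e : U -> U, (forall u, (D `|` A) u -> D (e u)) /\
      forall u v, (D `|` A) u -> (D `|` A) v -> e u = e v -> u = v.
  move=> jD j_inj.
  exists (fun u => if pselect (D u) then f (g 0%N, u) else f (g 1%N, j u)).
  split=> [u|u v].
    by case: pselect => Du [_|Au] //; apply: fD => //; exact: jD.
  case: pselect => Du; case: pselect => Dv.
  - by move=> _ _ /f_inj[].
  - by move=> _ [//|Av] /f_inj[]// ; exact: jD.
  - by move=> [//|Au] _ /f_inj[]// ; [exact: jD|move=> /esym].
  - move=> [//|Au] [//|Av] /f_inj[]; do ?exact: Dg; do ?exact: jD.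
    by move=> _; exact: j_inj.
(* [D] is compared with its complement. If the complement injects into [D], then [glue] embeds all
   of [U] in [D], and [f] after this embedding is the required operation. *)
have [[/(_ false)|/(_ true)] [j j_inj]] :=
  @exists_min_inj bool (fun b => set_type (if b then D else ~` D)) (inhabits true);
  last first.
  have [||e [eD e_inj]] := glue
    (fun u => if pselect ((~` D) u) is left nDu
              then val (j (SigSub (mem_set nDu))) else u) (~` D).
  - by move=> a nDa; case: pselect => // ?; apply: set_mem; exact: valP.
  - move=> a b nDa nDb; case: pselect => // ?; case: pselect => // ?.
    by move=> /val_inj/j_inj/(congr1 val).
  have DT u : (D `|` ~` D) u by rewrite setUv.
  exists (fun a b => f (e a, e b)) => a b c d.
  by move=> /f_inj[]; do ?[exact: eD]; move=> /e_inj-> // /e_inj->.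
pose j1 u := if pselect (D u) is left Du then val (j (SigSub (mem_set Du)))
             else u.
have j1D u : D u -> ~ D (j1 u).
  rewrite /j1; case: pselect => // Du _.
  by have /set_mem := valP (j (SigSub (mem_set Du))).
have j1_inj u v : D u -> D v -> j1 u = j1 v -> u = v.
  rewrite /j1; case: pselect => // Du; case: pselect => // Dv _ _.
  by move=> /val_inj/j_inj/(congr1 val).
have [u|k kP] := @choice U U (fun u v => (j1 @` D) u -> D v /\ j1 v = u).
  by have [[v Dv <-]|nu] := pselect ((j1 @` D) u); [exists v|exists u].
have [||e [eD e_inj]] := glue k (j1 @` D).
- by move=> a /kP[].
- by move=> a b /kP[_ {2}<-] /kP[_ {2}<-] ->.
set D' := D `|` j1 @` D in eD e_inj.
(* Here [j1] copies [D] into its complement. Pairs from [D'] with a component outside [D] get their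
   value in the copy, so [Y'] properly extends [Y], against maximality. *)
pose c a b := j1 (f (e a, e b)).
have cD' a b : D' a -> D' b -> (j1 @` D) (c a b).
  by move=> Da Db; exists (f (e a, e b)) => //; apply: fD; exact: eD.
have cD a b : D' a -> D' b -> ~ D (c a b).
  by move=> Da Db; apply: j1D; apply: fD; exact: eD.
pose Y' := Y `|` [set t | [/\ D' t.1.1, D' t.1.2,
  ~ (D t.1.1 /\ D t.1.2) & t.2 = c t.1.1 t.1.2]].
have fldY' : fld Y' = D'.
  apply/seteqP; split=> [a [d [Yd|[]]]//|a D'a]; first by left; exists d.
  have [Da|nDa] := pselect (D a); first by have [d ?] := Da; exists d; left.
  by exists (c a a); right; split=> //=; case.
have YD a b d : Y (a, b, d) -> D a /\ D b by move=> /Yfld[].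
have PY' : P Y'.
  split; rewrite ?fldY'.
  + move=> [a b] d d' [Yd|[/= D1 D2 nD ->]] [Yd'|[/= D1' D2' nD' ->]] //.
    * exact: Yfun Yd Yd'.
    * by case: nD'; exact: YD Yd.
    * by case: nD; exact: YD Yd'.
  + move=> [a b] [a' b'] d [Yd|[/= D1 D2 nD ->]] [Yd'|[/= D1' D2' nD']].
    * exact: Yinj Yd Yd'.
    * by move=> dE; case: (cD a' b') => //; rewrite -dE; have [] := Yfld _ _ _ Yd.
    * by case: (cD a b) => //; have [] := Yfld _ _ _ Yd'.
    * move=> /j1_inj/f_inj[]; do ?[by apply: fD; exact: eD]; do ?exact: eD.
      by move=> /e_inj-> // /e_inj->.
  + move=> a b d [/Yfld[? ? ?]|[/= D1 D2 nD ->]]; first by split; left.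
    by split=> //; right; exact: cD'.
  + move=> a b D'a D'b.
    have [[Da Db]|nD] := pselect (D a /\ D b).
      by have [d ?] := Ytot a b Da Db; exists d; left.
    by exists (c a b); right.
have Y'Y := maxY Y' (@subsetUl _ _ _) PY'.
case: (j1D (g 0%N) (Dg _)); set u := j1 _.
have : fld Y' u by rewrite fldY'; right; exists (g 0%N).
by move=> [d /Y'Y Yd]; exists d.
Qed.

Section InfiniteCardinals.
Variables (T : Type) (A : set T).
Hypothesis infA : infinite_set A.

Let cardTP (X : Type) : [set: X] #<= A <-> exists f : X -> A, injective f.
Proof. by rewrite -(card_le_eqr (card_setT A)); exact: card_leTT_injP. Qed.

Let pairing_fun : exists f : A -> A -> A,
  forall a b c d, f a b = f c d -> a = c /\ b = d.
Proof.
by have /infiniteP/cardTP[g /infinite_square_inj] := infA.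
Qed.

Lemma card_prod_le_infinite (X Y : Type) :
  [set: X] #<= A -> [set: Y] #<= A -> [set: X * Y] #<= A.
Proof.
move=> /cardTP[f f_inj] /cardTP[g g_inj]; apply/cardTP.
have [p p_inj] := pairing_fun.
by exists (fun x => p (f x.1) (g x.2)) => -[a b] [c d] /p_inj[/f_inj/= -> /g_inj/= ->].
Qed.

Lemma card_seq_le_infinite (X : Type) : [set: X] #<= A -> [set: seq X] #<= A.
Proof.
move=> /cardTP[f f_inj]; apply/cardTP; have [p p_inj] := pairing_fun.
have /infiniteP/cardTP[g g_inj] := infA.
(* [c] alone may identify sequences of different lengths, as [g 0] can be a value of [p]; hence the
   length is coded as well. *)
pose c (s : seq X) := foldr (fun x a => p (f x) a) (g 0%N) s.
exists (fun s => p (g (size s)) (c s)) => s t /p_inj[/g_inj].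
elim: s t => [|x s IHs] [|y t] //= [st] /p_inj[/f_inj-> cst].
by rewrite (IHs t).
Qed.

End InfiniteCardinals.

Lemma infinitized_infinite (T : Type) (A : set T) :
  infinite_set (infinitized A).
Proof.
rewrite /infinitized; case: asboolP => [_|infA]; apply/infiniteP.
  by rewrite (card_le_eqr (inj_card_eq _)) ?card_lexx// => m n _ _ [].
rewrite (card_le_eqr (inj_card_eq _)) => [|x y _ _ []//]; exact/infiniteP.
Qed.

Lemma card_le_infinitized (T : Type) (A : set T) : A #<= infinitized A.
Proof.
have := @infinitized_infinite _ A; rewrite /infinitized.
case: asboolP => [finA /infiniteP|infA _].
  exact/card_le_trans/finite_set_countable.
by rewrite (card_le_eqr (inj_card_eq _)) ?card_lexx// => x y _ _ [].
Qed.

Lemma infinitized_le (T U : Type) (A : set T) (C : set U) :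
  infinite_set C -> A #<= C -> infinitized A #<= C.
Proof.
move=> infC AC; rewrite /infinitized; case: asboolP => _.
  by apply: card_le_trans (card_image_le _ _) _; exact/infiniteP.
exact: card_le_trans (card_image_le _ _) _.
Qed.

Lemma exists_min_basis (T : topologicalType) : exists B : set (set T), min_basis B.
Proof.
have [|B basisB minB] := @exists_min_card _ (@basis T); last by exists B.
exists open; split=> // x A; rewrite nbhsE => -[B [oB Bx] BA].
by exists B.
Qed.

Lemma density_le_weightP (E T : topologicalType) (B : set (set T)) (C : set E) :
  min_basis B -> dense C -> C #<= infinitized B -> density_le_weight E T.
Proof.
move=> minB denseC CB.
have [|D denseD minD] := @exists_min_card _ (@dense E); first by exists C.
exists D, B; split=> //.
apply: infinitized_le; first exact: infinitized_infinite.
exact: card_le_trans (minD _ denseC) CB.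
Qed.

(** * Group seminorms and their construction from neighbourhoods of the unit *)

Record group_seminorm (R : realType) (G : groupType) (N : G -> R) : Prop := {
  seminorm_ge0 : forall x, 0 <= N x;
  seminorm_le1 : forall x, N x <= 1;
  seminorm1 : N 1%g = 0;
  seminormV : forall x, N (x^-1)%g = N x;
  seminormM : forall x y, N (x * y)%g <= N x + N y }.

Section GroupTopology.
Context {G : groupType} {tau : topology_on G}.
Hypothesis tau_group : group_topology tau.

Lemma continuous_mulgl (g : G) :
  continuous (fun x : topologized tau => (g * x : topologized tau)%g).
Proof.
move=> x A /(tau_group.1 (g, x)) [[B1 B2] [/= nB1 nB2] B12].
apply: filterS nB2 => y B2y; apply: (B12 (g, y)).
by split=> //=; exact: nbhs_singleton nB1.
Qed.

Lemma continuous_mulgr (g : G) :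
  continuous (fun x : topologized tau => (x * g : topologized tau)%g).
Proof.
move=> x A /(tau_group.1 (x, g)) [[B1 B2] [/= nB1 nB2] B12].
apply: filterS nB1 => y B1y; apply: (B12 (y, g)).
by split=> //=; exact: nbhs_singleton nB2.
Qed.

Lemma nbhs_mulg (g : G) (A : set G) : nbhs (1%g : topologized tau) A ->
  nbhs (g : topologized tau) [set x | A (g^-1 * x)%g].
Proof.
by move=> nA; have := @continuous_mulgl (g^-1)%g g A; rewrite /= mulVg => /(_ nA).
Qed.

Lemma nbhs_mulgJ (g : G) (A : set G) : nbhs (1%g : topologized tau) A ->
  nbhs (1%g : topologized tau) [set x | A (g^-1 * x * g)%g].
Proof.
move=> nA; have := @continuous_mulgr g (g^-1)%g A; rewrite /= mulVg => /(_ nA) nB.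
by have := @continuous_mulgl (g^-1)%g 1%g _; rewrite /= mulg1 => /(_ _ nB).
Qed.

(** Three factors are wanted because a word will be split into a left part, one letter and a right
    part. *)
Lemma nbhs1_mulg3 (W : set G) : nbhs (1%g : topologized tau) W ->
  exists W' : set G, [/\ nbhs (1%g : topologized tau) W',
    forall x, W' x -> W' (x^-1)%g &
    forall x y z, W' x -> W' y -> W' z -> W (x * (y * z))%g].
Proof.
have split (A : set G) : nbhs (1%g : topologized tau) A ->
    exists2 B : set G, nbhs (1%g : topologized tau) B &
    forall x y, B x -> B y -> A (x * y)%g.
  move=> A1; have := tau_group.1 (1%g, 1%g) A; rewrite /= mul1g => /(_ A1).
  move=> [[B1 B2] [/= nB1 nB2] B12]; exists (B1 `&` B2).
    exact: filterI.
  by move=> x y [B1x _] [_ B2y]; apply: (B12 (x, y)).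
move=> /split[B nB BW]; have [C nC CB] := split _ nB.
pose D := B `&` C.
have nD : nbhs (1%g : topologized tau) D by exact: filterI.
exists (D `&` [set x | D (x^-1)%g]); split.
- apply: filterI => //; have := tau_group.2 1%g D.
  by rewrite /= invg1 => /(_ nD).
- by move=> x [? ?]; split=> //=; rewrite invgK.
- by move=> x y z [[Bx _] _] [[_ Cy] _] [[_ Cz] _]; apply: BW => //; exact: CB.
Qed.

(* Birkhoff-Kakutani: [N x] is the infimum of the weights of the words
   representing [x], a letter of [U n] having weight [2 ^- n]; here
   [U n.+1] is symmetric with [U n.+1 ^ 3] inside [U n]. *)
Lemma exists_group_seminorm (R : realType) (V : set G) :
  nbhs (1%g : topologized tau) V ->
  exists N : G -> R, [/\ group_seminorm N,
    forall e, 0 < e -> nbhs (1%g : topologized tau) [set x | N x < e] &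
    forall x, N x < 2^-1 -> V x].
Proof.
move=> nV.
have [W|s sP] := @choice (set G) (set G) (fun W W' =>
    nbhs (1%g : topologized tau) W -> [/\ nbhs (1%g : topologized tau) W',
    forall x, W' x -> W' (x^-1)%g &
    forall x y z, W' x -> W' y -> W' z -> W (x * (y * z))%g]).
  have [/nbhs1_mulg3[W' ?]|nW] := pselect (nbhs (1%g : topologized tau) W).
    by exists W'.
  by exists set0 => /nW.
(* Starting from the whole group gives [N <= 1]; intersecting with [V] puts [U 1] inside [V], whence
   the threshold [2^-1]. *)
pose U n := iter n (fun W => s (W `&` V)) setT.
have nU n : nbhs (1%g : topologized tau) (U n).
  elim: n => [|n IHn] /=; first exact: filterT.
  by have [] := sP (U n `&` V) (filterI IHn nV).
have U3 n x y z : U n.+1 x -> U n.+1 y -> U n.+1 z -> (U n `&` V) (x * (y * z))%g.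
  by have [_ _] := sP (U n `&` V) (filterI (nU n) nV); exact.
have U1 n : U n 1%g by exact: nbhs_singleton (nU n).
have US n : U n.+1 `<=` U n.
  by move=> x Ux; have [] := U3 n x 1%g 1%g Ux (U1 _) (U1 _); rewrite !mulg1.
have Umono m n : (m <= n)%N -> U n `<=` U m.
  by move=> /subnK<-; elim: (n - m)%N => // k IHk x /US/IHk.
have UV n x : U n x -> U n (x^-1)%g.
  by case: n => // n; have [_ + _] := sP (U n `&` V) (filterI (nU n) nV); exact.
pose h : R := 2^-1.
have h0 : 0 < h by rewrite invr_gt0.
have h1 : h < 1 by rewrite invf_lt1// ltr1n.
pose w (t : seq (nat * G)) : R := \sum_(p <- t) h ^+ p.1.
pose pr (t : seq (nat * G)) := foldr (fun p x => (p.2 * x)%g) 1%g t.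
pose ok (t : seq (nat * G)) := forall p, p \in t -> U p.1 p.2.
have w_ge0 t : 0 <= w t by apply: sumr_ge0 => p _; rewrite exprn_ge0// ltW.
have w_cat t t' : w (t ++ t') = w t + w t' by rewrite /w big_cat.
have w_cons p t : w (p :: t) = h ^+ p.1 + w t by rewrite /w big_cons.
have pr_cat t t' : pr (t ++ t') = (pr t * pr t')%g.
  by elim: t => [|p t IHt] /=; rewrite ?mul1g// IHt mulgA.
(* [p] is the letter at which the partial weights pass [c]. *)
have cut t c : 0 <= c -> c < w t -> exists t1 p t2,
    [/\ t = t1 ++ p :: t2, w t1 <= c & c < w t1 + h ^+ p.1].
  elim: t c => [|p t IHt] c c0; first by rewrite /w big_nil ltNge c0.
  rewrite w_cons => cw; have [cp|pc] := ltP c (h ^+ p.1).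
    by exists [::], p, t; rewrite /w big_nil add0r.
  have [||t1 [q [t2 [-> t1c ct1]]]] := IHt (c - h ^+ p.1).
  - by rewrite subr_ge0.
  - by rewrite ltrBlDl.
  exists (p :: t1), q, t2; rewrite w_cons; split=> //.
    by rewrite -lerBrDl.
  by rewrite -addrA -ltrBlDl.
(* Induction on the length, cutting at half the weight. Both outer parts weigh at most
   [w t / 2 < h ^+ n.+1]; the middle letter weighs less than [h ^+ n], so its index exceeds [n]. All
   three factors lie in [U n.+1]. *)
have chain m t n : (size t <= m)%N -> ok t -> w t < h ^+ n -> U n (pr t).
  elim: m t n => [|m IHm] t n; first by rewrite leqn0 => /nilP->.
  have [->//|t0] := eqVneq t [::].
  move=> tm okt wt.
  have wt0 : 0 < w t.
    by case: t t0 {tm okt wt} => // p t _; rewrite w_cons ltr_pwDl// exprn_gt0.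
  have [||t1 [p [t2 [tE wt1 wt2]]]] := cut t (w t * h).
  - by rewrite mulr_ge0// ltW.
  - by rewrite gtr_pMr.
  have wE : w t = w t1 + (h ^+ p.1 + w t2) by rewrite tE w_cat w_cons.
  have hh : h + h = 1 by rewrite [RHS]splitr mul1r.
  have whh : w t * h + w t * h = w t by rewrite -mulrDr hh mulr1.
  have lt_half x : x <= w t * h -> x < h ^+ n.+1.
    by move=> /le_lt_trans; apply; rewrite exprSr ltr_pM2r.
  move: tm; rewrite tE size_cat /= addnS ltnS => tm.
  rewrite pr_cat /=; apply: proj1; apply: U3.
  - apply: IHm; first exact: leq_trans (leq_addr _ _) tm.
      by move=> q qt1; apply: okt; rewrite tE mem_cat qt1.
    exact: lt_half.
  - suff np : (n < p.1)%N.
      by apply: Umono np _ _; apply: okt; rewrite tE mem_cat inE eqxx orbT.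
    rewrite -(@ltr_iXn2l _ h)//; apply: le_lt_trans wt.
    by rewrite wE addrCA lerDl addr_ge0.
  - apply: IHm; first exact: leq_trans (leq_addl _ _) tm.
      by move=> q qt2; apply: okt; rewrite tE mem_cat inE qt2 !orbT.
    apply: lt_half; rewrite -(lerD2l (w t * h)) whh {2}wE addrA.
    by rewrite lerD2r ltW.
pose Ws x := [set w t | t in [set t | ok t /\ pr t = x]].
pose N x := inf (Ws x).
have Ws_lb x : has_lbound (Ws x) by exists 0 => _ [t _ <-].
have Nle t : ok t -> N (pr t) <= w t.
  by move=> okt; apply: ge_inf => //; exists t.
have NU n x : U n x -> N x <= h ^+ n.
  move=> Ux; have := Nle [:: (n, x)]; rewrite /= mulg1 w_cons /w big_nil addr0.
  by apply => p; rewrite inE => /eqP->.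
have Ws0 x : Ws x !=set0.
  exists (w [:: (0%N, x)]); exists [:: (0%N, x)] => //=; split; last by rewrite mulg1.
  by move=> p; rewrite inE => /eqP->.
have Napprox x e : 0 < e -> exists t, [/\ ok t, pr t = x & w t < N x + e].
  move=> e0; have [|_ [t [okt prt] <-] wt] := @inf_adherent _ (Ws x) e e0.
    by split.
  by exists t.
have okcons p t : ok (p :: t) -> U p.1 p.2 /\ ok t.
  move=> okpt; split; first by apply: okpt; rewrite mem_head.
  by move=> q qt; apply: okpt; rewrite inE qt orbT.
have N_ge0 x : 0 <= N x by apply: lb_le_inf => // _ [t _ <-].
have NV x : N (x^-1)%g <= N x.
  apply/ler_addgt0Pr => e e0; have [t [okt <- wt]] := Napprox x e e0.
  apply: le_trans (ltW wt).
  (* Reversing a word and inverting its letters keeps its weight, and keeps it admissible because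
     each [U n] is symmetric. *)
  suff [t' [okt' <- <-]] : exists t', [/\ ok t', pr t' = (pr t)^-1%g & w t' = w t].
    exact: Nle.
  elim: t {wt} okt => [|p t IHt] okt; first by exists [::]; rewrite /= invg1.
  have [Up /IHt[t' [okt' prt' wt']]] := okcons _ _ okt.
  exists (t' ++ [:: (p.1, (p.2^-1)%g)]); split.
  - move=> q; rewrite mem_cat inE => /orP[/okt'//|/eqP-> /=].
    exact: UV.
  - by rewrite pr_cat /= prt' mulg1 invgM.
  - by rewrite w_cat !w_cons /w big_nil -!/(w _) wt' /= addr0 addrC.
exists N; split.
- split=> //.
  + by move=> x; rewrite (le_trans (NU 0%N x I))// expr0.
  + apply/eqP; rewrite eq_le N_ge0 andbT.
    by have := Nle [::]; rewrite /w big_nil; exact.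
  + by move=> x; apply/eqP; rewrite eq_le NV -{1}(invgK x) NV.
  + move=> x y; apply/ler_addgt0Pr => e e0.
    have e20 : 0 < e / 2 by rewrite divr_gt0.
    have [t [okt <- wt]] := Napprox x _ e20.
    have [t' [okt' <- wt']] := Napprox y _ e20.
    rewrite -pr_cat; apply: (@le_trans _ _ (w (t ++ t'))).
      by apply: Nle => p; rewrite mem_cat => /orP[/okt|/okt'].
    by rewrite w_cat (splitr e) addrACA lerD// ltW.
- move=> e e0.
  have /cvgrPdist_lt/(_ e e0) : (fun n => h ^+ n) @ \oo --> (0 : R).
    by apply: cvg_expr; rewrite gtr0_norm.
  move=> [n _ /(_ n (leqnn n))] /=.
  rewrite sub0r normrN gtr0_norm ?exprn_gt0// => hn.
  by apply: filterS (nU n) => x /NU/le_lt_trans; apply.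
- move=> x Nx.
  have [t [okt <- wt]] := Napprox x (h - N x) ltac:(by rewrite subr_gt0).
  have /(chain _ _ 1%N (leqnn _) okt) Ut : w t < h ^+ 1.
    by rewrite expr1; move: wt; rewrite addrC subrK.
  by have [_] := U3 0%N (pr t) 1%g 1%g Ut (U1 _) (U1 _); rewrite !mulg1.
Qed.

End GroupTopology.

(** * The uniformly closed span of a family of functions, as a Banach space *)

Section ClosedSpan.
Context {R : realType} {S J : Type} (a : J -> S -> R).

Definition lin_comb (l : seq (R * J)) (s : S) : R := \sum_(p <- l) p.1 * a p.2 s.

(** Boundedness is part of the predicate so that the supremum norm is finite for every family
    [a]. *)
Definition in_cspan (f : S -> R) : Prop :=
  (exists M, forall s, `|f s| <= M) /\
  forall e, 0 < e -> exists l, forall s, `|f s - lin_comb l s| <= e.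

Definition cspan : {pred S -> R} := fun f => `[< in_cspan f >].

Record cspan_type := CSpan { cspan_val :> S -> R; cspan_valP : cspan_val \in cspan }.

HB.instance Definition _ := [isSub for cspan_val].
HB.instance Definition _ := gen_eqMixin cspan_type.
HB.instance Definition _ := [Choice of cspan_type by <:].

Lemma lin_comb_scale c l s :
  lin_comb [seq (c * p.1, p.2) | p <- l] s = c * lin_comb l s.
Proof.
rewrite /lin_comb big_map mulr_sumr; apply: eq_bigr => p _ /=.
by rewrite mulrA.
Qed.

Lemma cspan_submod_closed : submod_closed cspan.
Proof.
split=> [|c f g /asboolP[[M Mf] fE] /asboolP[[M' Mg] gE]]; apply/asboolP; split.
- by exists 0 => s; rewrite normr0.
- move=> e e0; exists [::] => s.
  by rewrite /lin_comb big_nil subrr normr0 ltW.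
- exists (`|c| * M + M') => s.
  rewrite (le_trans (ler_normD _ _))// lerD// normrM.
  exact: ler_wpM2l.
- move=> e e0.
  have c0 : 0 < `|c| + 1 by rewrite ltr_wpDl.
  have [l fl] := fE (e / 2 / (`|c| + 1)) ltac:(by rewrite !divr_gt0).
  have [l' gl'] := gE (e / 2) ltac:(by rewrite divr_gt0).
  exists ([seq (c * p.1, p.2) | p <- l] ++ l') => s.
  rewrite {1}/lin_comb big_cat -!/(lin_comb _ _) lin_comb_scale.
  rewrite (_ : (c *: f + g) s = c * f s + g s)// opprD addrACA -mulrBr.
  rewrite (splitr e) (le_trans (ler_normD _ _))// lerD// normrM.
  apply: (@le_trans _ _ (`|c| * (e / 2 / (`|c| + 1)))); first exact: ler_wpM2l.
  rewrite mulrCA; apply: ler_piMr; first by rewrite divr_ge0// ltW.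
  by rewrite ler_pdivrMr// mul1r lerDl.
Qed.

HB.instance Definition _ :=
  GRing.isSubmodClosed.Build R (S -> R) cspan cspan_submod_closed.
HB.instance Definition _ := [SubChoice_isSubLmodule of cspan_type by <:].

Implicit Types f g : cspan_type.

Lemma cspan_ext f g : f =1 g -> f = g.
Proof. by move=> fg; apply: val_inj; exact: funext. Qed.

Lemma cspanD f g s : (f + g) s = f s + g s. Proof. by []. Qed.
Lemma cspanB f g s : (f - g) s = f s - g s. Proof. by []. Qed.
Lemma cspanZ c f s : (c *: f) s = c * f s. Proof. by []. Qed.
Lemma cspan0 s : (0 : cspan_type) s = 0. Proof. by []. Qed.

Definition sup_norm f : R := sup (range (fun s => `|f s|)).

Lemma le_sup_norm f s : `|f s| <= sup_norm f.
Proof.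
apply: ub_le_sup; last by exists s.
have /asboolP[[M Mf] _] := cspan_valP f.
by exists M => _ [t _ <-].
Qed.

Lemma sup_norm_le f M : 0 <= M -> (forall s, `|f s| <= M) -> sup_norm f <= M.
Proof.
move=> M0 fM; rewrite /sup_norm; set A := (X in sup X).
(* For empty [S], [sup] takes its default value [0]. *)
have [->|/set0P A0] := eqVneq A set0; first by rewrite sup0.
by apply: ge_sup => // _ [s _ <-].
Qed.

Lemma sup_norm_ge0 f : 0 <= sup_norm f.
Proof.
have [[s _]|S0] := pselect ([set: S] !=set0).
  exact: le_trans (normr_ge0 _) (le_sup_norm f s).
rewrite /sup_norm; set A := (X in sup X); suff -> : A = set0 by rewrite sup0.
by apply/seteqP; split=> // x [s]; case: S0; exists s.
Qed.

Lemma sup_normD f g : sup_norm (f + g) <= sup_norm f + sup_norm g.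
Proof.
apply: sup_norm_le => [|s]; first by rewrite addr_ge0 ?sup_norm_ge0.
by rewrite cspanD (le_trans (ler_normD _ _))// lerD// le_sup_norm.
Qed.

Lemma sup_normZ c f : sup_norm (c *: f) = `|c| * sup_norm f.
Proof.
have leZ d g : sup_norm (d *: g) <= `|d| * sup_norm g.
  apply: sup_norm_le => [|s]; first by rewrite mulr_ge0 ?sup_norm_ge0.
  by rewrite cspanZ normrM ler_wpM2l// le_sup_norm.
have [->|c0] := eqVneq c 0.
  apply/eqP; rewrite eq_le leZ normr0 mul0r; exact: sup_norm_ge0.
apply/eqP; rewrite eq_le leZ /= -ler_pdivlMl ?normr_gt0//.
by rewrite -normfV -{1}[f](scalerK c0) leZ.
Qed.

Lemma sup_norm_eq0 f : sup_norm f = 0 -> f = 0.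
Proof.
move=> f0; apply: cspan_ext => s; apply/eqP.
by rewrite cspan0 -normr_le0 -f0 le_sup_norm.
Qed.

HB.instance Definition _ := Lmodule_isNormed.Build R cspan_type
  sup_normD sup_normZ sup_norm_eq0.

(** A Cauchy filter has a pointwise limit, uniformly close to suitable elements of the span; the
    limit inherits from them boundedness and approximability. *)
Lemma cspan_complete (F : set_system cspan_type) :
  ProperFilter F -> cauchy F -> cvg F.
Proof.
move=> FF /cauchyP Fc.
have Fc' e : 0 < e -> exists f, F [set g | `|f - g| < e].
  by move=> /Fc [f]; rewrite -ball_normE; exists f.
have Fs s : cvg ((fun f : cspan_type => f s) @ F).
  apply/cauchy_cvgP/cauchyP => e /Fc'[f Ff]; exists (f s).
  rewrite -ball_normE /=; apply: filterS Ff => g /=.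
  by apply: le_lt_trans; rewrite -cspanB; exact: le_sup_norm.
pose h s := lim ((fun f : cspan_type => f s) @ F).
have hE e f : F [set g | `|f - g| < e] -> forall s, `|h s - f s| <= e.
  move=> Ff s; apply/ler_addgt0Pl => d d0.
  have /cvgrPdist_lt/(_ d d0) Fd := Fs s.
  have [g [/= hg fg]] := filter_ex (filterI Fd Ff).
  rewrite -(subrK (g s) (h s)) -addrA (le_trans (ler_normD _ _))// lerD ?ltW//.
  by rewrite distrC -cspanB; exact: le_lt_trans (le_sup_norm _ _) fg.
have hP : h \in cspan.
  apply/asboolP; split.
    have [f /hE hf] := Fc' 1 ltr01; exists (1 + `|f|) => s.
    rewrite -(subrK (f s) (h s)) (le_trans (ler_normD _ _))// lerD//.
    exact: le_sup_norm.
  move=> e e0; have e20 : 0 < e / 2 by rewrite divr_gt0.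
  have [f /hE hf] := Fc' _ e20.
  have /asboolP[_ /(_ _ e20)[l fl]] := cspan_valP f.
  exists l => s; rewrite -(subrK (f s) (h s)) -addrA (splitr e).
  by rewrite (le_trans (ler_normD _ _))// lerD.
apply/cvg_ex; exists (CSpan hP); apply/cvgrPdist_lt => e e0.
have e20 : 0 < e / 2 by rewrite divr_gt0.
have [f Ff] := Fc' _ e20; apply: filterS (Ff) => g /= fg.
rewrite -(subrK f (CSpan hP)) -addrA (splitr e).
rewrite (le_lt_trans (ler_normD _ _))// ler_ltD//.
by apply: sup_norm_le => [|s]; [exact: ltW|exact: hE Ff s].
Qed.

HB.instance Definition _ := Uniform_isComplete.Build cspan_type cspan_complete.

(** A finite linear relation between point evaluations passes from the generators to their
    combinations and then to uniform limits. All identities on [cspan_type] that are not pointwise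
    evident come from here. *)
Lemma cspan_eval_eq0 (t : seq (R * S)) :
  (forall j, \sum_(q <- t) q.1 * a j q.2 = 0) ->
  forall f, \sum_(q <- t) q.1 * f q.2 = 0.
Proof.
move=> t0 f; apply/eqP; rewrite -normr_le0; apply/ler_addgt0Pl => e e0.
rewrite addr0; set c := \sum_(q <- t) `|q.1|.
have c0 : 0 <= c by apply: sumr_ge0.
have c10 : 0 < c + 1 by rewrite ltr_wpDl.
have /asboolP[_ fE] := cspan_valP f.
have [l fl] := fE (e / (c + 1)) (divr_gt0 e0 c10).
have l0 : \sum_(q <- t) q.1 * lin_comb l q.2 = 0.
  under eq_bigr do rewrite mulr_sumr.
  rewrite exchange_big big1// => p _ /=.
  under eq_bigr do rewrite mulrCA.
  by rewrite -mulr_sumr t0 mulr0.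
have -> : \sum_(q <- t) q.1 * f q.2 =
    \sum_(q <- t) q.1 * (f q.2 - lin_comb l q.2).
  by under [RHS]eq_bigr do rewrite mulrBr; rewrite sumrB l0 subr0.
apply: le_trans (ler_norm_sum _ _ _) _.
apply: (@le_trans _ _ (c * (e / (c + 1)))).
  by rewrite mulr_suml ler_sum// => q _; rewrite normrM ler_wpM2l.
by rewrite mulrCA; apply: ler_piMr; rewrite ?ler_pdivrMr ?mul1r ?lerDl// ltW.
Qed.

(** The default [0] of [insubd] allows a total definition; for bounded families [genE] shows that it
    never occurs. *)
Definition gen (j : J) : cspan_type := insubd 0 (a j).

Hypothesis a_bounded : forall j, exists M : R, forall s, `|a j s| <= M.

Lemma genE j s : gen j s = a j s.
Proof.
rewrite -[gen j s]/(val (gen j) s) val_insubd ifT//.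
apply/asboolP; split=> // e e0; exists [:: (1, j)] => t.
by rewrite /lin_comb big_seq1 mul1r subrr normr0 ltW.
Qed.

Lemma gen_sumE (l : seq (R * J)) s :
  (\sum_(p <- l) p.1 *: gen p.2) s = lin_comb l s.
Proof.
rewrite /lin_comb; elim: l => [|p l IHl]; first by rewrite !big_nil.
by rewrite !big_cons cspanD cspanZ genE IHl.
Qed.

Lemma cspan_approx f (e : R) : 0 < e ->
  exists l : seq (R * J), `|f - \sum_(p <- l) p.1 *: gen p.2| <= e.
Proof.
move=> e0; have /asboolP[_ /(_ _ e0)[l fl]] := cspan_valP f; exists l.
by apply: sup_norm_le => [|s]; rewrite ?(ltW e0)// cspanB gen_sumE.
Qed.

Lemma dense_rat_comb (D : set J) :
  (forall j (e : R), 0 < e -> exists2 j', D j' & `|gen j - gen j'| <= e) ->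
  dense [set \sum_(p <- l) ratr p.1 *: gen (val p.2) |
          l in [set: seq (rat * D)]].
Proof.
move=> approx O [f Of] Oo.
have /nbhs_ballP[e e0] : nbhs f O by exact: open_nbhs_nbhs.
rewrite -ball_normE => eO.
have e20 : 0 < e / 2 by rewrite divr_gt0.
have e40 : 0 < e / 2 / 2 by rewrite divr_gt0.
have [l fl] := cspan_approx f e40.
suff [l' ll'] : exists l' : seq (rat * D),
    `|\sum_(p <- l) p.1 *: gen p.2 -
      \sum_(p <- l') ratr p.1 *: gen (val p.2)| <= e / 2.
  exists (\sum_(p <- l') ratr p.1 *: gen (val p.2)); split; last by exists l'.
  apply: eO => /=; rewrite -(subrK (\sum_(p <- l) p.1 *: gen p.2) f) -addrA.
  rewrite (splitr e) (le_lt_trans (ler_normD _ _))// ltr_leD//.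
  by rewrite (le_lt_trans fl)// gtr_pMr// invf_lt1 ?ltr1n.
elim: l (e / 2) e20 {fl} => [|p l IHl] d d0.
  by exists [::]; rewrite !big_nil subrr normr0 ltW.
have d20 : 0 < d / 2 by rewrite divr_gt0.
have [l' ll'] := IHl _ d20.
have d40 : 0 < d / 2 / 2 by rewrite divr_gt0.
have g0 : 0 < `|gen p.2| + 1 by rewrite ltr_wpDl.
(* The rational [q] comes before [j'], since the tolerance for the generator depends on [q]. Each of
   the two replacements costs at most [d / 4]; adding [1] keeps the denominators positive. *)
have [q] := rat_in_itvoo (ltr_pwDr (divr_gt0 d40 g0) (lexx p.1)).
rewrite in_itv /= => /andP[pq qp].
have q0 : 0 < `|ratr q : R| + 1 by rewrite ltr_wpDl.
have [j' Dj' jj'] := approx p.2 _ (divr_gt0 d40 q0).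
exists ((q, SigSub (mem_set Dj')) :: l'); rewrite !big_cons /=.
rewrite opprD addrACA (le_trans (ler_normD _ _))// (splitr d) lerD//.
rewrite -(subrK (ratr q *: gen p.2) (p.1 *: gen p.2)) -addrA -scalerBl -scalerBr.
rewrite (le_trans (ler_normD _ _))// (splitr (d / 2)) lerD// normrZ.
  apply: (@le_trans _ _ (d / 2 / 2 / (`|gen p.2| + 1) * `|gen p.2|)).
    apply: ler_wpM2r => //; rewrite distrC ger0_norm ?subr_ge0 ?(ltW pq)//.
    by rewrite lerBlDl ltW.
  rewrite mulrAC -mulrA; apply: ler_piMr; first exact: ltW.
  by rewrite ler_pdivrMr// mul1r lerDl.
apply: (@le_trans _ _ (`|ratr q| * (d / 2 / 2 / (`|ratr q : R| + 1)))).
  exact: ler_wpM2l.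
rewrite mulrCA; apply: ler_piMr; first exact: ltW.
by rewrite ler_pdivrMr// mul1r lerDl.
Qed.

End ClosedSpan.

(** * Isometric translation actions on closed spans and their continuity *)

Section TranslationAction.
Context {R : realType} {S J : Type} (a : J -> S -> R) {G : groupType}.
Variables (actS : G -> S -> S) (actJ : G -> J -> J).
Hypothesis a_bounded : forall j, exists M : R, forall s, `|a j s| <= M.
Hypothesis actS1 : forall s, actS 1%g s = s.
Hypothesis actSM : forall g h s, actS (g * h)%g s = actS g (actS h s).
Hypothesis a_act : forall g j s, a (actJ g j) s = a j (actS (g^-1)%g s).

Implicit Types f : cspan_type a.

Lemma translate_subproof g f : (fun s => f (actS (g^-1)%g s)) \in cspan a.
Proof.
have /asboolP[[M fM] fE] := cspan_valP f; apply/asboolP; split; first by exists M.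
move=> e /fE[l fl]; exists [seq (p.1, actJ g p.2) | p <- l] => s.
by rewrite /lin_comb big_map; under eq_bigr do rewrite /= a_act; exact: fl.
Qed.

Definition translate g f : cspan_type a := CSpan (translate_subproof g f).

Lemma translateE g f s : translate g f s = f (actS (g^-1)%g s).
Proof. by []. Qed.

Lemma translateM g h f : translate (g * h)%g f = translate g (translate h f).
Proof. by apply: cspan_ext => s; rewrite !translateE invgM actSM. Qed.

Lemma translate1 f : translate 1%g f = f.
Proof. by apply: cspan_ext => s; rewrite translateE invg1 actS1. Qed.

Lemma translate_linear g : linear (translate g).
Proof. by move=> c f f'; exact: cspan_ext. Qed.

Lemma translate_norm g f : `|translate g f| = `|f|.
Proof.
have le h f' : `|translate h f'| <= `|f'|.
  apply: sup_norm_le => [|s]; first exact: normr_ge0.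
  exact: (le_sup_norm f').
by apply/eqP; rewrite eq_le le -{1}(translate1 f) -(mulVg g) translateM le.
Qed.

Lemma translate_onto g f : exists f', translate g f' = f.
Proof. by exists (translate (g^-1)%g f); rewrite -translateM mulgV translate1. Qed.

Definition translate_iso g : Iso (cspan_type a) :=
  MkIso (translate_linear g) (translate_norm g) (translate_onto g).

Lemma translate_isoM : {morph translate_iso : g h / (g * h)%g}.
Proof. by move=> g h; apply: iso_ext => f; exact: translateM. Qed.

Definition translation : {multiplicative G -> Iso (cspan_type a)} :=
  HB.pack translate_iso (isMultiplicative.Build _ _ translate_iso translate_isoM).

Lemma translationE g f s : translation g f s = f (actS (g^-1)%g s).
Proof. by []. Qed.

Lemma translation_gen g j : translation g (gen a j) = gen a (actJ g j).
Proof. by apply: cspan_ext => s; rewrite translationE !genE// a_act. Qed.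

Context {tau : topology_on G}.
Hypothesis tau_group : group_topology tau.
Hypothesis gen_orbit : forall j (e : R), 0 < e ->
  nbhs (1%g : topologized tau) [set g | `|gen a (actJ g j) - gen a j| <= e].

(** Because translations are isometries, continuity of orbits at the unit extends from generators to
    finite combinations, and to limits by an [e / 3] argument. *)
Lemma translation_orbit f (e : R) : 0 < e ->
  nbhs (1%g : topologized tau) [set g | `|translation g f - f| <= e].
Proof.
move=> e0; have e30 : 0 < e / 3 by rewrite divr_gt0.
have [l fl] := cspan_approx a_bounded f e30.
set f' := \sum_(p <- l) _ in fl.
suff : nbhs (1%g : topologized tau) [set g | `|translation g f' - f'| <= e / 3].
  apply: filterS => g gf'; rewrite /mkset.
  rewrite -(subrK (translation g f') (translation g f)) -iso_opp -addrA.
  rewrite -(subrK f' (translation g f')) -[_ - f' + f' - f]addrA.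
  have -> : e = e / 3 + (e / 3 + e / 3) by lra.
  rewrite (le_trans (ler_normD _ _))// lerD ?iso_norm//.
  rewrite (le_trans (ler_normD _ _))// lerD// distrC.
  exact: fl.
rewrite /f' {f' fl}; elim: l (e / 3) e30 => [|p l IHl] d d0.
  rewrite big_nil; apply: filterE => g; rewrite /mkset.
  by rewrite -{1}(subrr 0) iso_opp !subrr normr0 ltW.
have d20 : 0 < d / 2 by rewrite divr_gt0.
have p0 : 0 < `|p.1| + 1 by rewrite ltr_wpDl.
apply: filterS (filterI (IHl _ d20) (gen_orbit p.2 (divr_gt0 d20 p0))) => g [].
move=> gl gp; rewrite /mkset big_cons iso_linear opprD addrACA.
rewrite (le_trans (ler_normD _ _))// (splitr d) lerD//.
rewrite -scalerBr normrZ translation_gen.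
apply: (@le_trans _ _ (`|p.1| * (d / 2 / (`|p.1| + 1)))); first exact: ler_wpM2l.
by rewrite mulrCA; apply: ler_piMr; rewrite ?ler_pdivrMr ?mul1r ?lerDl// ltW.
Qed.

Lemma translation_continuous :
  continuous (translation : topologized tau -> Iso (cspan_type a)).
Proof.
move=> g0.
have FF : Filter ((translation : topologized tau -> Iso (cspan_type a)) @ g0).
  by apply: fmap_filter; exact: nbhs_filter.
apply/iso_cvgP => f; apply/cvgrPdist_le => e e0.
apply: filterS (nbhs_mulg tau_group g0 (translation_orbit f e0)) => g gf.
rewrite -[_ g]/(`|translation g0 f - translation g f| <= e : Prop).
(* Factoring out the isometry at [g0] reduces continuity at [g0] to continuity at the unit. *)
have -> : translation g f = translation g0 (translation (g0^-1 * g)%g f).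
  by rewrite -{1}(mulVKg g0 g) gmulfM.
by rewrite distrC -iso_opp iso_norm.
Qed.

End TranslationAction.

(** Rational combinations of the generators [phi x] are dense and are indexed by finite sequences,
    which are no more numerous than an infinite set bounding [X]. *)
Lemma cspan_density (R : realType) (S J X : Type) (a : J -> S -> R)
    (T : topologicalType) (B : set (set T)) (phi : X -> J) :
  (forall j, exists M : R, forall s, `|a j s| <= M) ->
  min_basis B -> [set: X] #<= infinitized B ->
  (forall j (e : R), 0 < e -> exists x, `|gen a j - gen a (phi x)| <= e) ->
  density_le_weight (cspan_type a) T.
Proof.
move=> a_bounded minB XB approx.
have infB := @infinitized_infinite _ B.
apply: (density_le_weightP minB (dense_rat_comb a_bounded (D := range phi) _)).
  by move=> j e /(approx j)[x jx]; exists (phi x) => //; exists x.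
apply: card_le_trans (card_image_le _ _) _.
apply: card_seq_le_infinite => //; apply: card_prod_le_infinite => //.
  apply: card_le_trans (countableP _) _; exact/infiniteP.
rewrite (card_le_eql (card_setT _)).
exact: card_le_trans (card_image_le _ _) _.
Qed.

(** * Hölder difference quotients, molecules and the duality between their spans *)

Section HolderDuality.
Context {R : realType} {G : groupType} {I : Type} (N : I -> G -> R).
Hypothesis N_seminorm : forall i, group_seminorm (N i).

Local Notation point := (I * G * G)%type.

(** A point [(i, h, k)] stands for the pair [h], [k] in the [i]-th copy of [G]; [holder] is the
    square root of their left-invariant distance. *)
Definition holder (s : point) : R := Num.sqrt (N s.1.1 (s.1.2^-1 * s.2)%g).

(* [holder_quotient (i, g)] is the Hölder-[1/2] difference quotient of the function
   [h |-> N i (h^-1 * g)]; at points where the distance vanishes it is [0]. *)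
Definition holder_quotient (j : I * G) (s : point) : R :=
  `[< s.1.1 = j.1 >]%:R *
  ((N s.1.1 (s.1.2^-1 * j.2)%g - N s.1.1 (s.2^-1 * j.2)%g) / holder s).

Definition diag (g : G) (s : point) : point := (s.1.1, (g * s.1.2)%g, (g * s.2)%g).
Definition shift (g : G) (j : I * G) : I * G := (j.1, (g * j.2)%g).

Lemma diag1 s : diag 1%g s = s.
Proof. by case: s => [[i h] k]; rewrite /diag /= !mul1g. Qed.

Lemma diagM g h s : diag (g * h)%g s = diag g (diag h s).
Proof. by rewrite /diag /= !mulgA. Qed.

Lemma holder_diag g s : holder (diag g s) = holder s.
Proof. by rewrite /holder /= invgM -mulgA mulKg. Qed.

Lemma quotient_shift g j s :
  holder_quotient (shift g j) s = holder_quotient j (diag (g^-1)%g s).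
Proof.
by rewrite /holder_quotient holder_diag /= !invgM !invgK !mulgA.
Qed.

Lemma holder_ge0 s : 0 <= holder s. Proof. exact: sqrtr_ge0. Qed.

Lemma holder_sqr s : holder s ^+ 2 = N s.1.1 (s.1.2^-1 * s.2)%g.
Proof. by rewrite sqr_sqrtr// seminorm_ge0. Qed.

(** In [N i (h^-1 * g)] this bound controls a change of [g], and [seminorm_distV] a change of
    [h]. *)
Lemma seminorm_dist i x y : `|N i x - N i y| <= N i (x^-1 * y)%g.
Proof.
have le u v : N i u - N i v <= N i (v^-1 * u)%g.
  by rewrite lerBlDl -{1}(mulVKg v u) seminormM.
rewrite ler_norml lerNl opprB le /=.
by rewrite -(seminormV (N_seminorm i) (x^-1 * y)%g) invgM invgK.
Qed.

Lemma seminorm_distV i x y : `|N i x - N i y| <= N i (x * y^-1)%g.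
Proof.
rewrite -(seminormV (N_seminorm i) x) -(seminormV (N_seminorm i) y).
by rewrite (le_trans (seminorm_dist _ _ _))// invgK.
Qed.

(* The interpolation [min (p ^ 2) (q ^ 2) / p <= q] which makes the action on
   [holder_space] norm continuous. *)
Lemma norm_quotient_le (d p q : R) : 0 <= p -> 0 <= q ->
  `|d| <= 2 * p ^+ 2 -> `|d| <= 2 * q ^+ 2 -> `|d / p| <= 2 * q.
Proof.
move=> p0 q0 dp dq; have [->|pn0] := eqVneq p 0.
  by rewrite invr0 mulr0 normr0 mulr_ge0.
have {}p0 : 0 < p by rewrite lt_def pn0.
rewrite normrM normfV (gtr0_norm p0) ler_pdivrMr//.
have [pq|/ltW qp] := leP p q; [apply: le_trans dp _|apply: le_trans dq _].
  by rewrite -mulrA ler_pM2l// expr2 ler_wpM2r// ltW.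
by rewrite -mulrA ler_pM2l// expr2 ler_wpM2l.
Qed.

(** Interpolation with [q = 1]: the numerator is at most [holder s ^+ 2], and at most [2] because
    [N <= 1]. *)
Lemma quotient_bounded j : exists M : R, forall s, `|holder_quotient j s| <= M.
Proof.
exists 2 => -[[i h] k]; rewrite normrM -[2]mul1r ler_pM//.
  by case: asboolP => _; rewrite ?normr1 ?normr0.
rewrite -[2]mulr1; apply: norm_quotient_le; rewrite ?holder_ge0//.
  rewrite holder_sqr (le_trans (seminorm_distV _ _ _))//=.
  rewrite invgM invgK mulgA mulgK.
  by rewrite ler_peMl ?seminorm_ge0// ler1n.
rewrite expr1n mulr1 (le_trans (ler_normB _ _))//.
by rewrite !ger0_norm ?seminorm_ge0// -[2]/(1 + 1) lerD ?seminorm_le1.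
Qed.

Definition holder_space : completeNormedModType R := cspan_type holder_quotient.

Local Notation E := holder_space.

Implicit Type x : E.

(** The numerator of the difference is a double difference. Grouped in two ways, it is at most twice
    the distance of the pair of points and twice that of the base points, so [norm_quotient_le]
    applies. *)
Lemma gen_quotient_dist i g g' :
  `|gen holder_quotient (i, g) - gen holder_quotient (i, g')| <=
  2 * holder (i, g, g').
Proof.
apply: sup_norm_le => [|[[i' h] k]]; first by rewrite mulr_ge0 ?holder_ge0.
rewrite cspanB !genE; try exact: quotient_bounded.
rewrite /holder_quotient /= -mulrBr -mulrBl.
case: asboolP => [->|_]; last by rewrite mul0r normr0 mulr_ge0 ?holder_ge0.
have dist2 (u v u' v' c : R) : `|u - v| <= c -> `|u' - v'| <= c ->
    `|u - v - (u' - v')| <= 2 * c.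
  move=> uv uv'; rewrite (le_trans (ler_normB _ _))//.
  by rewrite mulr_natl mulr2n lerD.
rewrite mul1r; apply: norm_quotient_le; rewrite ?holder_ge0// holder_sqr /=.
  by apply: dist2; rewrite (le_trans (seminorm_distV _ _ _))//
    invgM invgK mulgA mulgK.
have swap (u v u' v' : R) : u - v - (u' - v') = u - u' - (v - v') by lra.
by rewrite swap; apply: dist2;
  rewrite (le_trans (seminorm_dist _ _ _))// invgM invgK -mulgA mulVKg.
Qed.

Lemma holder_quotientK j s : holder s * holder_quotient j s =
  `[< s.1.1 = j.1 >]%:R *
  (N s.1.1 (s.1.2^-1 * j.2)%g - N s.1.1 (s.2^-1 * j.2)%g).
Proof.
rewrite /holder_quotient mulrCA; congr (_ * _).
have [h0|h0] := eqVneq (holder s) 0; last by rewrite mulrC divfK.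
rewrite h0 mul0r; apply/esym/eqP; rewrite -normr_le0.
rewrite (le_trans (seminorm_distV _ _ _))// invgM invgK mulgA mulgK.
by rewrite -holder_sqr h0 expr0n.
Qed.

(** Multiplication by [holder] turns quotients back into differences of a function on one copy of
    [G], which telescope. *)
Lemma holder_cocycle x i h k l :
  holder (i, h, k) * x (i, h, k) + holder (i, k, l) * x (i, k, l) =
  holder (i, h, l) * x (i, h, l).
Proof.
have := @cspan_eval_eq0 _ _ _ holder_quotient
  [:: (holder (i, h, k), (i, h, k)); (holder (i, k, l), (i, k, l));
      (- holder (i, h, l), (i, h, l))] _ x.
rewrite !big_cons !big_nil addr0 /= mulNr addrA => H.
apply/eqP; rewrite -subr_eq0; apply/eqP; apply: H => j.
rewrite !big_cons !big_nil addr0 /= mulNr !holder_quotientK /=.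
by rewrite addrA -mulrDr -mulrBr addrA subrK subrr mulr0.
Qed.

Lemma holder_eq0 x s : holder s = 0 -> x s = 0.
Proof.
move=> s0; have := @cspan_eval_eq0 _ _ _ holder_quotient [:: (1, s)] _ x.
rewrite big_seq1 mul1r; apply => j.
by rewrite big_seq1 /= /holder_quotient s0 invr0 !mulr0.
Qed.

(* The functional [x |-> holder s * x s], divided by the norm so that the dual norm
   becomes a supremum norm; the value at [x = 0] is [0]. *)
Definition molecule (s : point) (x : E) : R := holder s * x s / `|x|.

Lemma molecule_le s x : `|molecule s x| <= holder s.
Proof.
rewrite /molecule -mulrA normrM (ger0_norm (holder_ge0 _)).
apply: ler_piMr; first exact: holder_ge0.
rewrite normrM normfV normr_id.
have [->|x0] := eqVneq x 0; first by rewrite cspan0 normr0 mul0r.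
by rewrite ler_pdivrMr ?normr_gt0// mul1r; exact: le_sup_norm.
Qed.

Lemma molecule_bounded s : exists M : R, forall x, `|molecule s x| <= M.
Proof. by exists (holder s) => x; exact: molecule_le. Qed.

Lemma moleculeK s x : `|x| * molecule s x = holder s * x s.
Proof.
rewrite /molecule mulrC; have [->|x0] := eqVneq x 0; last by rewrite divfK ?normr_eq0.
by rewrite cspan0 mulr0 !mul0r.
Qed.

(** The regrouping [(u h - u k) - (u h' - u k') = (u h - u h') - (u k - u k')], which bounds the
    distance of two molecules by those of their end points. *)
Lemma molecule_swap i h k h' k' x :
  molecule (i, h, k) x - molecule (i, h', k') x =
  molecule (i, h, h') x - molecule (i, k, k') x.
Proof.
rewrite /molecule -!mulrBl; congr (_ / _).
rewrite -(holder_cocycle x i h h' k) -(holder_cocycle x i h' k k').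
by rewrite opprD addrA addrK.
Qed.

Definition molecule_space : completeNormedModType R := cspan_type molecule.

Local Notation F := molecule_space.

Implicit Type f : F.

Lemma gen_molecule_dist i h k h' k' :
  `|gen molecule (i, h, k) - gen molecule (i, h', k')| <=
  holder (i, h, h') + holder (i, k, k').
Proof.
apply: sup_norm_le => [|x]; first by rewrite addr_ge0 ?holder_ge0.
rewrite cspanB !genE; try exact: molecule_bounded.
by rewrite molecule_swap (le_trans (ler_normB _ _))// lerD// molecule_le.
Qed.

(** * The pairing: bilinearity, continuity and strong duality *)

Definition omega_fun (x : E) (f : F) : R := `|x| * f x.

Lemma omega_gen x s : omega_fun x (gen molecule s) = holder s * x s.
Proof. by rewrite /omega_fun genE ?moleculeK//; exact: molecule_bounded. Qed.

(** Linearity in [x] is a relation between the values of [f] at three points, weighted by their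
    norms; it holds for molecules, hence for every [f]. *)
Lemma omega_bilinear : bilinear_for *%R *%R omega_fun.
Proof.
split=> [f c x y|x c f f']; last first.
  by rewrite /omega_fun cspanD cspanZ mulrDr mulrCA.
have := @cspan_eval_eq0 _ _ _ molecule
  [:: (`|c *: x + y|, c *: x + y); (- (c * `|x|), x); (- `|y|, y)] _ f.
rewrite !big_cons !big_nil addr0 /= !mulNr -opprD => H.
apply/eqP; rewrite -subr_eq0 /omega_fun mulrA; apply/eqP; apply: H => s.
rewrite !big_cons !big_nil addr0 /= !mulNr -opprD -mulrA !moleculeK.
by rewrite cspanD cspanZ mulrDr mulrCA subrr.
Qed.

Definition omega : {bilinear E -> F -> R | *%R & *%R} :=
  HB.pack omega_fun (bilinear_isBilinear.Build _ _ _ _ _ _ omega_fun omega_bilinear).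

Lemma omegaE x f : omega x f = `|x| * f x. Proof. by []. Qed.

Lemma omega_regular : regular_duality omega.
Proof.
move=> x f; rewrite omegaE normrM normr_id ler_wpM2l//.
exact: le_sup_norm.
Qed.

Lemma omega_continuous : continuous (fun p : E * F => omega p.1 p.2).
Proof.
move=> [x0 f0]; apply/cvgrPdist_le => /= e e0.
have c0 : 0 < `|x0| + `|f0| + 1 by rewrite ltr_wpDl ?addr_ge0.
pose d := Num.min 1 (e / 2 / (`|x0| + `|f0| + 1)).
have d0 : 0 < d by rewrite lt_min ltr01 !divr_gt0.
have nx : nbhs x0 [set x | `|x0 - x| < d].
  by apply: (@cvgr_dist_lt _ _ _ (nbhs x0)).
have nf : nbhs f0 [set f | `|f0 - f| < d].
  by apply: (@cvgr_dist_lt _ _ _ (nbhs f0)).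
exists ([set x | `|x0 - x| < d], [set f | `|f0 - f| < d]) => // -[x f] /= [xd fd].
have -> : omega x0 f0 - omega x f = omega (x0 - x) f + omega x0 (f0 - f).
  by rewrite linearBl linearBr; lra.
have fle : `|f| <= `|f0| + 1.
  rewrite -[f](subrK f0) addrC (le_trans (ler_normD _ _))// lerD2l distrC.
  by rewrite (le_trans (ltW fd))// ge_min lexx.
have dle : d * (`|x0| + `|f0| + 1) <= e / 2.
  by rewrite -ler_pdivlMr// ge_min lexx orbT.
rewrite (splitr e) (le_trans (ler_normD _ _))// lerD//.
  rewrite (le_trans (omega_regular _ _))// (le_trans _ dle)//.
  by rewrite ler_pM ?(ltW xd)// (le_trans fle)// -addrA lerDr.
rewrite (le_trans (omega_regular _ _))// (le_trans _ dle)// mulrC.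
by rewrite ler_pM ?(ltW fd)// -addrA lerDl addr_ge0.
Qed.

(** The molecule at [s] divided by [holder s] lies in the unit ball of [F] and evaluates [x] at [s],
    so that ball recovers the norm of [E]. *)
Lemma left_strong_omega : left_strong omega.
Proof.
move=> x unbx bnd; apply: unbx; rewrite /= /bounded_near.
near=> M => _ [n _ <-] /=.
have M0 : 0 <= M by near: M; exact: nbhs_pinfty_ge.
apply: sup_norm_le => // s.
have [s0|s0] := eqVneq (holder s) 0; first by rewrite holder_eq0// normr0.
pose f : F := (holder s)^-1 *: gen molecule s.
have -> : x n s = omega (x n) f.
  by rewrite linearZr_LR /= omega_gen mulKf.
suff : globally [set omega (x n) f | n in [set: nat] & f in unit_ball F]
    [set y | `|y| <= M].
  apply; exists n => //; exists f => //; rewrite /unit_ball /=.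
  rewrite normrZ normfV (ger0_norm (holder_ge0 _)) ler_pdivrMl ?mulr1.
    apply: sup_norm_le => [|y]; first exact: holder_ge0.
    by rewrite genE ?molecule_le//; exact: molecule_bounded.
  by rewrite lt_def s0 holder_ge0.
by near: M.
Unshelve. all: by end_near. Qed.

(** For [x != 0], [f x] is the pairing of [f] with the unit vector along [x]; at [x = 0] every [f]
    vanishes. *)
Lemma right_strong_omega : right_strong omega.
Proof.
move=> f unbf bnd; apply: unbf; rewrite /= /bounded_near.
near=> M => _ [n _ <-] /=.
have M0 : 0 <= M by near: M; exact: nbhs_pinfty_ge.
apply: sup_norm_le => // x.
have [->|x0] := eqVneq x 0.
  have := @cspan_eval_eq0 _ _ _ molecule [:: (1, 0 : E)] _ (f n).
  rewrite big_seq1 /= mul1r => ->; first by rewrite normr0.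
  by move=> s; rewrite big_seq1 /= /molecule normr0 invr0 !mulr0.
pose y : E := `|x|^-1 *: x.
have -> : f n x = omega y (f n).
  by rewrite linearZl_LR /= /omega_fun mulKf ?normr_eq0.
suff : globally [set omega x (f n) | n in [set: nat] & x in unit_ball E]
    [set y | `|y| <= M].
  by apply; exists n => //; exists y => //; rewrite /unit_ball /= normfZV.
by near: M.
Unshelve. all: by end_near. Qed.

(** * The two actions of the group and their continuity *)

Definition quotient_translation : {multiplicative G -> Iso E} :=
  translation diag1 diagM quotient_shift.

Lemma quotient_translationE g x s :
  quotient_translation g x s = x (diag (g^-1)%g s).
Proof. by []. Qed.

Lemma quotient_translation_gen g j :
  quotient_translation g (gen holder_quotient j) = gen holder_quotient (shift g j).
Proof. by apply: translation_gen; exact: quotient_bounded. Qed.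

Lemma quotient_translation1 x : quotient_translation 1%g x = x.
Proof. exact: (translate1 diag1 quotient_shift). Qed.

Lemma quotient_translationM g h x : quotient_translation (g * h)%g x =
  quotient_translation g (quotient_translation h x).
Proof. exact: (translateM diagM quotient_shift). Qed.

Lemma molecule_diag g s x :
  molecule (diag g s) x = molecule s (quotient_translation (g^-1)%g x).
Proof.
by rewrite /molecule holder_diag iso_norm quotient_translationE invgK.
Qed.

(** The contragredient action: elements of [F] are functions on [E], and [G] acts on their
    argument. *)
Definition molecule_translation : {multiplicative G -> Iso F} :=
  translation quotient_translation1 quotient_translationM molecule_diag.

Lemma molecule_translationE g f x :
  molecule_translation g f x = f (quotient_translation (g^-1)%g x).
Proof. by []. Qed.

Lemma omega_invariant g x f :
  omega (quotient_translation g x) (molecule_translation g f) = omega x f.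
Proof.
rewrite !omegaE iso_norm molecule_translationE -quotient_translationM mulVg.
by rewrite quotient_translation1.
Qed.

Context {tau : topology_on G}.
Hypothesis tau_group : group_topology tau.
Hypothesis N_continuous : forall i (e : R), 0 < e ->
  nbhs (1%g : topologized tau) [set x | N i x < e].

Lemma holder_near1 i (e : R) : 0 < e ->
  nbhs (1%g : topologized tau) [set x | Num.sqrt (N i x) <= e].
Proof.
move=> e0; apply: filterS (N_continuous i (exprn_gt0 2 e0)) => x /= /ltW xe.
by rewrite -(ger0_norm (ltW e0)) -sqrtr_sqr ler_wsqrtr.
Qed.

(** Left translation by [g] moves the base point [x] by the distance [N i (x^-1 * g * x)], small
    near the unit since conjugation is continuous. *)
Lemma quotient_orbit j (e : R) : 0 < e -> nbhs (1%g : topologized tau)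
  [set g | `|gen holder_quotient (shift g j) - gen holder_quotient j| <= e].
Proof.
case: j => i x e0; have e20 : 0 < e / 2 by rewrite divr_gt0.
apply: filterS (nbhs_mulgJ tau_group x (holder_near1 i e20)) => g /= gxe.
rewrite distrC (le_trans (gen_quotient_dist _ _ _))// mulrC -ler_pdivlMr//.
by rewrite /holder /= mulgA.
Qed.

Lemma molecule_orbit s (e : R) : 0 < e -> nbhs (1%g : topologized tau)
  [set g | `|gen molecule (diag g s) - gen molecule s| <= e].
Proof.
case: s => [[i h] k] e0; have e20 : 0 < e / 2 by rewrite divr_gt0.
have nh := nbhs_mulgJ tau_group h (holder_near1 i e20).
have nk := nbhs_mulgJ tau_group k (holder_near1 i e20).
apply: filterS (filterI nh nk) => g [/= ghe gke].
rewrite distrC (le_trans (gen_molecule_dist _ _ _ _ _))// (splitr e).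
by rewrite /holder /= !mulgA lerD.
Qed.

Definition holder_birepresentation : birepresentation tau E F :=
  @Birepresentation R G tau E F omega omega_continuous
    quotient_translation
    (translation_continuous quotient_bounded tau_group quotient_orbit)
    molecule_translation
    (translation_continuous molecule_bounded tau_group molecule_orbit)
    omega_invariant.

Hypothesis N_separates : forall V : set G, nbhs (1%g : topologized tau) V ->
  exists i, forall x : G, N i x < 2^-1 -> V x.

(* The quotient of [N i] based at [x] and that based at [1] differ by
   [2 * sqrt (N i x)] at the point [(i, 1, x)]. *)
Lemma quotient_dist_ge i (x : G) :
  2 * Num.sqrt (N i x) <=
  `|gen holder_quotient (i, x) - gen holder_quotient (i, 1%g)|.
Proof.
apply: le_trans (le_sup_norm _ (i, 1%g, x)).
rewrite cspanB !genE; try exact: quotient_bounded.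
rewrite /holder_quotient /holder /= asboolT// !mul1r invg1 !mul1g mulVg mulg1.
rewrite seminorm1// seminormV// subr0 sub0r mulNr opprK.
rewrite -mulrDl -mulr2n -(mulr_natl (N i x)) -mulrA.
apply: le_trans (ler_norm _).
rewrite ler_pM2l//; have [x0|x0] := eqVneq (Num.sqrt (N i x)) 0.
  by rewrite x0 invr0 mulr0.
by rewrite ler_pdivlMr -?expr2 ?sqr_sqrtr ?seminorm_ge0// lt_def x0 sqrtr_ge0.
Qed.

(** If the action on [E] is continuous for [tau'], a [tau']-neighbourhood of the unit moves
    [gen holder_quotient (i, 1)] by less than [1]. There [2 * Num.sqrt (N i z) < 1], so
    [N i z < 2^-1], and [tau]-open sets are [tau']-open. *)
Lemma holder_t_exact : t_exact1 holder_birepresentation.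
Proof.
move=> tau' tau'_group [_ tautau']; exists tt; left => act; apply: tautau'.
move=> O Oo.
have oO : open (O : set (topologized tau)) by [].
suff : open (O : set (topologized tau')) by [].
rewrite openE => g Og.
have : nbhs (1%g : topologized tau) [set x | O (g * x)%g].
  have := @continuous_mulgl _ _ tau_group g 1%g O; rewrite /= mulg1; apply.
  exact: open_nbhs_nbhs.
move=> /N_separates[i iO].
have := act (1%g, gen holder_quotient (i, 1%g)).
move=> /cvgrPdist_lt/(_ 1 ltr01) [[A B] [/= nA nB] AB].
apply: filterS (nbhs_mulg tau'_group g nA) => y Ay.
rewrite -(mulVKg g y); apply: iO.
have := AB (g^-1 * y, gen holder_quotient (i, 1))%g (conj Ay (nbhs_singleton nB)).
rewrite /= -[X in `|X - _|]/(quotient_translation 1%g _) quotient_translation1.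
rewrite -[X in `|_ - X|]/(quotient_translation _ _) quotient_translation_gen.
rewrite distrC /shift /= mulg1 => lt1.
have := le_lt_trans (quotient_dist_ge i (g^-1 * y)%g) lt1.
set z := (g^-1 * y)%g; have := sqr_sqrtr (seminorm_ge0 (N_seminorm i) z).
have := sqrtr_ge0 (N i z); nra.
Qed.

Lemma holder_density (B : set (set (topologized tau))) :
  min_basis B -> [set: I] #<= infinitized B ->
  density_le_weight E (topologized tau) /\ density_le_weight F (topologized tau).
Proof.
move=> minB IB.
have infB := @infinitized_infinite _ B.
(* One point from each basis member, with [1] as default for an empty member, gives a dense set no
   larger than the basis. *)
pose D := [set xget (1%g : topologized tau) V | V in B].
have DB : [set: D] #<= infinitized B.
  rewrite (card_le_eql (card_setT _)).
  apply: card_le_trans (card_image_le _ _) (card_le_infinitized _).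
have approx i h (e : R) : 0 < e -> exists d : D, holder (i, h, val d) <= e.
  move=> e0; have := nbhs_mulg tau_group h (holder_near1 i e0).
  move=> /(minB.1.2 h) [V [BV Vh] VA].
  have DV : D (xget (1%g : topologized tau) V) by exists V.
  exists (SigSub (mem_set DV)); apply: VA => /=.
  exact: (xgetI _ Vh).
split.
- apply: (@cspan_density _ _ _ (I * D) _ _ B (fun p => (p.1, val p.2))) => //.
  + exact: quotient_bounded.
  + exact: card_prod_le_infinite.
  + move=> [i h] e e0; have e20 : 0 < e / 2 by rewrite divr_gt0.
    have [d hd] := approx i h _ e20; exists (i, d).
    by rewrite (le_trans (gen_quotient_dist _ _ _))// mulrC -ler_pdivlMr.
- apply: (@cspan_density _ _ _ (I * D * D) _ _ B
    (fun p => (p.1.1, val p.1.2, val p.2))) => //.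
  + exact: molecule_bounded.
  + by do 2?apply: card_prod_le_infinite.
  + move=> [[i h] k] e e0; have e20 : 0 < e / 2 by rewrite divr_gt0.
    have [d hd] := approx i h _ e20; have [d' kd'] := approx i k _ e20.
    exists (i, d, d'); rewrite (le_trans (gen_molecule_dist _ _ _ _ _))//.
    by rewrite (splitr e) lerD.
Qed.

End HolderDuality.

Theorem theorem7p1 (R : realType) (G : groupType) (tau : topology_on G)
    (tau_group : group_topology tau)
    (tau_hausdorff : hausdorff_space (topologized tau)) :
  BR_group R tau /\
  exists (E F : completeNormedModType R) (Psi : birepresentation tau E F),
    [/\ t_exact1 Psi,
        regular_duality (pairing Psi),
        strong_duality (pairing Psi),
        density_le_weight E (topologized tau) &
        density_le_weight F (topologized tau)].
Proof.
(* The first claim is the one-element system of the second. *)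
suff [E [F [Psi [exactPsi regPsi strongPsi dE dF]]]] : exists
    (E F : completeNormedModType R) (Psi : birepresentation tau E F),
    [/\ t_exact1 Psi, regular_duality (pairing Psi), strong_duality (pairing Psi),
        density_le_weight E (topologized tau) &
        density_le_weight F (topologized tau)].
  split; last by exists E, F, Psi.
  by exists unit, (fun=> E), (fun=> F), (fun=> Psi).
have [B minB] := exists_min_basis (topologized tau).
(* These members form a neighbourhood base at the unit, hence separate, and are at most as many as
   the weight. *)
pose I := {V : set G | B V /\ V 1%g}.
have exN (i : I) := exists_group_seminorm tau_group R
  (open_nbhs_nbhs (conj (minB.1.1 _ (svalP i).1) (svalP i).2)).
pose N i := projT1 (cid (exN i)).
have N_seminorm i : group_seminorm (N i) by have [] := projT2 (cid (exN i)).
have N_continuous i (e : R) : 0 < e ->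
    nbhs (1%g : topologized tau) [set x | N i x < e].
  by have [_ + _] := projT2 (cid (exN i)); exact.
have N_separates V : nbhs (1%g : topologized tau) V ->
    exists i, forall x, N i x < 2^-1 -> V x.
  move=> /(minB.1.2 (1%g : topologized tau))[W BW WV].
  exists (exist _ W BW) => x Nx; apply: WV.
  by have [_ _] := projT2 (cid (exN (exist _ W BW))); exact.
have IB : [set: I] #<= infinitized B.
  apply: card_le_trans (card_le_infinitized B).
  rewrite -(card_le_eqr (card_setT B)); apply/card_leTT_injP.
  exists (fun i : I => SigSub (mem_set (svalP i).1) : B).
  by move=> [V BV] [W BW] /(congr1 val) /= VW; exact: eq_exist.
have [dE dF] := holder_density N_seminorm tau_group N_continuous minB IB.
exists (holder_space N), (molecule_space N).
exists (holder_birepresentation N_seminorm tau_group N_continuous).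
split=> //.
- exact: holder_t_exact.
- exact: omega_regular.
- by split; [exact: left_strong_omega|exact: right_strong_omega].
Qed.
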